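(* Let $k \geq 1$, let $p_1 < p_2 < \dots < p_k$ be the first $k$ prime numbers and $P_k = \prod_{i=1}^k p_i$. Let $r_1, \ldots, r_k$ be arbitrary integers (a residue class $r_i$ modulo $p_i$ for each $i$), and for $1 \le n \le P_k$ let $\gamma(n) = \#\{ i \in \{1,\dots,k\} : n \equiv r_i \pmod{p_i}\}$. Then, for every such choice of $r_1,\dots,r_k$, $$\#\{ n \in \{1,\dots,P_k\} : \gamma(n) \le 1\} = a_k \quad\text{and}\quad \#\{ n \in \{1,\dots,P_k\} : \gamma(n) = 0\} = f_k,$$ where $a_k$ is the determinant of the $k\times k$ matrix with diagonal entries $p_1,\dots,p_k$ and all off-diagonal entries equal to $1$, and $f_k = (-1)^k \det M_k$, where $M_k$ is the $(k+1)\times(k+1)$ matrix whose first row consists entirely of ones and, for $1 \le i \le k$, whose row $i+1$ has entry $p_i$ in column $i$ and entry $1$ in every other column (so in particular the last column consists entirely of ones).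
   Context: Integers $n$ with $\gamma(n)\le 1$ are called available and those with $\gamma(n)=0$ are called free. *)

(* Defs.v *)
From mathcomp Require Import all_boot all_order all_algebra.
Set Implicit Arguments.
Unset Strict Implicit.
Unset Printing Implicit Defensive.
Import GRing.Theory.

Lemma next_prime_ex (n : nat) : exists q : nat, (n < q) && prime q.
Proof. by have [q lt_nq pr_q] := prime_above n; exists q; rewrite lt_nq pr_q. Qed.

Definition next_prime (n : nat) : nat := ex_minn (next_prime_ex n).

(* Indices start at 0: [nth_prime i] is the prime p_(i+1), so that           *)
(* nth_prime 0 = 2, nth_prime 1 = 3, nth_prime 2 = 5.                        *)
Definition nth_prime (i : nat) : nat := iter i.+1 next_prime 0.

Definition primorial (k : nat) : nat := \prod_(i < k) nth_prime i.

Definition gamma (k : nat) (r : 'I_k -> int) (n : nat) : nat :=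
  #|[set i : 'I_k | (n%:Z == r i %[mod (nth_prime i)%:Z])%Z]|.

Definition available (k : nat) (r : 'I_k -> int) (n : nat) : bool :=
  gamma r n <= 1.

Definition free_int (k : nat) (r : 'I_k -> int) (n : nat) : bool :=
  gamma r n == 0.

Local Open Scope ring_scope.

Definition avail_mx (k : nat) : 'M[int]_k :=
  \matrix_(i < k, j < k) if i == j then (nth_prime i)%:Z else 1.

(* With rows and columns numbered from 0, the entry p_i in row i+1 and       *)
(* column i becomes [nth_prime j] in row j+1 and column j.                   *)
Definition free_mx (k : nat) : 'M[int]_k.+1 :=
  \matrix_(i < k.+1, j < k.+1)
    if (i : nat) == j.+1 then (nth_prime j)%:Z else 1.

Definition avail_det (k : nat) : int := \det (avail_mx k).

Definition free_det (k : nat) : int := (-1) ^+ k * \det (free_mx k).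

(* Main.v *)
Require Import Defs.
From mathcomp Require Import all_boot all_order all_algebra.
From mathcomp Require Import ring.
Set Implicit Arguments.
Unset Strict Implicit.
Unset Printing Implicit Defensive.
Import GRing.Theory.
Local Open Scope ring_scope.

(** By the Chinese remainder theorem, [n] over a period is equidistributed over
    all tuples of residues, so the generating polynomial
    [\sum_n 'X^(gamma n)] factors as [\prod_i ((p_i - 1) + 'X)].  The free
    integers are counted by its coefficient of degree 0, the available ones by
    the sum of its coefficients of degrees 0 and 1.  Both determinants reduce to
    the same expressions by subtracting the row of ones from the other rows. *)

(** The map [h] from [n] to its pair of remainders is injective by the Chinese remainder theorem,
    hence bijective by cardinality; it reindexes the expanded product. *)
Lemma sum_chinese (R : comNzRingType) (m q : nat) (F G : nat -> R) :
  (0 < m)%N -> (0 < q)%N -> coprime m q ->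
  \sum_(n < m * q) F (n %% m)%N * G (n %% q)%N
    = (\sum_(a < m) F a) * (\sum_(b < q) G b).
Proof.
move=> m_gt0 q_gt0 co_mq; rewrite big_distrlr /= pair_big /=.
pose h (n : 'I_(m * q)) : 'I_m * 'I_q :=
  (Ordinal (ltn_pmod n m_gt0), Ordinal (ltn_pmod n q_gt0)).
have h_inj : injective h.
  move=> x y [eq_m eq_q]; apply/val_inj/eqP => /=.
  rewrite -(modn_small (ltn_ord x)) -(modn_small (ltn_ord y)).
  by rewrite chinese_remainder // eq_m eq_q !eqxx.
rewrite [RHS](reindex h) //=.
by apply/onW_bij/(inj_card_bij h_inj); rewrite card_prod !card_ord.
Qed.

(** Induction on [s], splitting off one modulus at a time: it is coprime to the product of the
    others, and reducing modulo that product first does not change the remainders modulo its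
    factors. *)
Lemma sum_chinese_prod (R : comNzRingType) (I : eqType) (s : seq I)
    (p : I -> nat) (F : I -> nat -> R) :
  (forall i, 0 < p i)%N -> (forall i j, i != j -> coprime (p i) (p j)) ->
  uniq s ->
  \sum_(n < \prod_(i <- s) p i) \prod_(i <- s) F i (n %% p i)%N
    = \prod_(i <- s) \sum_(a < p i) F i a.
Proof.
move=> p_gt0 co_p; elim: s => [|i s IHs] /= => [_|/andP[i_s uniq_s]].
  by rewrite !big_nil big_ord1 big_nil.
rewrite [RHS]big_cons -IHs // big_cons.
rewrite -(@sum_chinese _ _ _ (F i)
  (fun m => \prod_(j <- s) F j (m %% p j)%N)) //; first last.
- rewrite coprime_sym big_seq;
  apply: (big_rec (coprime^~ (p i))) => [|j m j_s co_m]; last first.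
    by rewrite coprimeMl co_m andbT co_p //; apply: contraNneq i_s => <-.
  by rewrite coprime1n.
- by rewrite prodn_gt0.
apply: eq_bigr => n _; rewrite big_cons; congr (_ * _).
apply: eq_big_seq => j j_s; rewrite modn_dvdm //.
by rewrite (big_rem j j_s) dvdn_mulr.
Qed.

(** Subtracting the border row of ones from every other row leaves an upper triangular matrix; the
    first factor below undoes this subtraction. *)
Lemma det_offdiag1_border (R : comNzRingType) (k : nat) (a : 'I_k -> R) :
  \det (block_mx 1%:M (const_mx 1) (const_mx 1)
          (\matrix_(i, j) if i == j then a i else 1) : 'M_(1 + k))
    = \prod_i (a i - 1).
Proof.
rewrite [X in \det X](_ : _ =
  block_mx 1%:M 0 (const_mx 1) 1%:M *m
  block_mx 1%:M (const_mx 1) 0 (diag_mx (\row_i (a i - 1)))).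
  rewrite det_mulmx det_lblock det_ublock !det1 !mul1r det_diag.
  by apply: eq_bigr => i _; rewrite mxE.
rewrite mulmx_block !mul1mx !mul0mx !addr0 mulmx1; congr block_mx.
apply/matrixP => i j; rewrite !mxE big_ord1 !mxE mulr1.
by case: eqP => [->|_]; rewrite ?mulr1n ?mulr0n ?addr0 // addrC subrK.
Qed.

(** The first row is the row of ones plus [a ord0 - 1] times the first unit row. Linearity in that
    row gives the bordered matrix [B] and the block triangular matrix [C]. *)
Lemma det_offdiag1_recl (R : comNzRingType) (k : nat) (a : 'I_k.+1 -> R) :
  \det (\matrix_(i, j) if i == j then a i else 1)
    = \prod_(i < k) (a (lift ord0 i) - 1)
      + (a ord0 - 1) *
        \det (\matrix_(i < k, j < k) if i == j then a (lift ord0 i) else 1).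
Proof.
set A := \matrix_(i < k, j < k) _.
pose B := block_mx 1%:M (const_mx 1) (const_mx 1) A : 'M_(1 + k).
pose C := block_mx (a ord0 - 1)%:M 0 (const_mx 1) A : 'M_(1 + k).
have detC : \det (C : 'M_k.+1) = (a ord0 - 1) * \det A.
  by rewrite -[X in X * _]det_scalar1 -(det_lblock _ (const_mx 1)).
have := @determinant_multilinear R k.+1
  (\matrix_(i, j) if i == j then a i else 1) B C ord0 1 1.
rewrite /B det_offdiag1_border detC !mul1r; apply.
- rewrite !scale1r; apply/rowP => j.
  rewrite 2![LHS]mxE [RHS]mxE [row _ B _ _]mxE [row _ C _ _]mxE.
  rewrite (_ : ord0 = lshift k ord0 :> 'I_(1 + k)); last exact: val_inj.
  rewrite -[j](@splitK 1 k j); case: (@split 1 k j) => j' /=.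
    rewrite !block_mxEul !ord1 eqxx !mxE !mulr1n addrC subrK.
    by congr (a _); apply: val_inj.
  by rewrite !block_mxEur !mxE addr0.
(* It remains to see that [B] and [C] agree with the original matrix outside the first row. *)
all: apply/matrixP => i j; rewrite [LHS]mxE 2![RHS]mxE.
all: rewrite (_ : lift ord0 i = rshift 1 i); last exact: val_inj.
all: rewrite -[j](@splitK 1 k j); case: (@split 1 k j) => j' /=.
1,3: by rewrite (@block_mxEdl _ 1 k 1 k) mxE (@eq_rlshift 1 k).
all: rewrite (@block_mxEdr _ 1 k 1 k) mxE (inj_eq (@rshift_inj 1 k)).
all: by rewrite (_ : rshift 1 i = lift ord0 i) //; apply: val_inj.
Qed.

Lemma coef0_prod_CaddX (R : comNzRingType) (k : nat) (c : 'I_k -> R) :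
  (\prod_i ((c i)%:P + 'X))`_0 = \prod_i c i.
Proof.
rewrite -horner_coef0 horner_prod; apply: eq_bigr => i _.
by rewrite !hornerE.
Qed.

(** Both sides obey the same recursion: if [T = (c + 'X) * Q], then the two lowest coefficients of
    [T] sum to [Q_0 + c * (Q_0 + Q_1)]. *)
Lemma det_offdiag1 (R : comNzRingType) (k : nat) (a : 'I_k -> R) :
  let T := \prod_i ((a i - 1)%:P + 'X) in
  \det (\matrix_(i, j) if i == j then a i else 1) = T`_0 + T`_1.
Proof.
elim: k a => [|k IHk] a /=.
  by rewrite det_mx00 big_ord0 !coef1 addr0.
rewrite det_offdiag1_recl IHk big_ord_recl -coef0_prod_CaddX.
set Q := \prod_(i < k) _.
rewrite [in RHS]mulrDl !coefD !coefCM !coefXM /=; ring.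
Qed.

Lemma det_subdiag_row1 (R : comNzRingType) (k : nat) (a : nat -> R) :
  \det (\matrix_(i < k.+1, j < k.+1) if (i : nat) == j.+1 then a j else 1)
    = (-1) ^+ k * \prod_(i < k) (a i - 1).
Proof.
pose D : 'M[R]_(k, k.+1) :=
  \matrix_(i, j) if (i : nat) == j then a j - 1 else 0.
pose N : 'M[R]_(1 + k, k.+1) := col_mx (const_mx 1) D.
rewrite [X in \det X](_ : _ =
    (block_mx 1%:M 0 (const_mx 1) 1%:M : 'M_(1 + k)) *m N); last first.
  rewrite mul_block_col !mul1mx mul0mx addr0.
  apply/matrixP => i j; rewrite [LHS]mxE.
  rewrite -[i](@splitK 1 k i); case: (@split 1 k i) => i' /=.
    by rewrite (@col_mxEu _ 1 k) ord1 !mxE.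
  rewrite (@col_mxEd _ 1 k) !mxE big_ord1 !mxE add1n eqSS mulr1.
  by case: eqP; rewrite ?addr0 // addrC subrK.
(* After the row of ones is subtracted, the last column of [N] is zero below its top entry, so one
   cofactor survives. Its position [(0, k)] yields the sign. *)
rewrite det_mulmx (@det_lblock _ 1 k) !det1 !mul1r (expand_det_col _ ord_max).
rewrite (bigD1 ord0) //= big1 ?addr0 => [|i]; last first.
  case: (unliftP ord0 i) => [i' -> _|->]; last by rewrite eqxx.
  rewrite (_ : lift ord0 i' = rshift 1 i'); last exact: val_inj.
  by rewrite (@col_mxEd _ 1 k) mxE ltn_eqF ?mul0r // ltn_ord.
have -> : N ord0 ord_max = 1.
  rewrite (_ : ord0 = lshift k ord0 :> 'I_(1 + k)); last exact: val_inj.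
  by rewrite col_mxEu mxE.
rewrite mul1r /cofactor add0n; congr (_ * _).
rewrite [X in \det X](_ : _ = diag_mx (\row_(i < k) (a i - 1))).
  by rewrite det_diag; apply: eq_bigr => i _; rewrite mxE.
apply/matrixP => i j; rewrite 2![LHS]mxE [RHS]mxE [X in X *+ _]mxE.
rewrite (_ : @lift k.+1 ord0 i = rshift 1 i); last exact: val_inj.
rewrite (@col_mxEd _ 1 k) mxE lift_max -val_eqE /=.
by case: eqP => [->|].
Qed.

Lemma next_primeP n : (n < next_prime n)%N && prime (next_prime n).
Proof. by rewrite /next_prime; case: ex_minnP. Qed.

Lemma nth_prime_prime i : prime (nth_prime i).
Proof. by have /andP[] := next_primeP (iter i next_prime 0%N). Qed.

Lemma nth_prime_ltn : {homo nth_prime : i j / (i < j)%N}.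
Proof.
apply: homo_ltn => [y x z|i]; first exact: ltn_trans.
by have /andP[] := next_primeP (nth_prime i).
Qed.

Lemma nth_prime_inj : injective nth_prime.
Proof. exact: incn_inj (leq_mono nth_prime_ltn). Qed.

Lemma eqz_modnE (n p : nat) (r : int) : (0 < p)%N ->
  (n%:Z == r %[mod p%:Z])%Z = ((n %% p)%N == `|(r %% p%:Z)%Z|%N).
Proof.
move=> p_gt0; rewrite modz_nat -eqz_nat gez0_abs // modz_ge0 //.
by rewrite eqz_nat -lt0n.
Qed.

(** Each factor depends only on one remainder of [n], the shape that [sum_chinese_prod] requires. *)
Lemma Xn_gammaE (k : nat) (r : 'I_k -> int) (n : nat) :
  'X^(gamma r n) = \prod_(i < k)
    (if (n %% nth_prime i)%N == `|(r i %% (nth_prime i)%:Z)%Z|%N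
     then 'X else 1) :> {poly int}.
Proof.
rewrite -big_mkcond /= prodr_const; congr (_ ^+ _).
apply: eq_card => i; rewrite !inE; apply: eqz_modnE.
exact/prime_gt0/nth_prime_prime.
Qed.

(** Modulo each prime, exactly one residue contributes ['X] and the remaining [p - 1] residues
    contribute 1. *)
Lemma sum_X_gamma (k : nat) (r : 'I_k -> int) :
  \sum_(n < (primorial k).+1 | (0 < n)%N) 'X^(gamma r n)
    = \prod_(i < k) (((nth_prime i)%:Z - 1)%:P + 'X) :> {poly int}.
Proof.
have p_gt0 (i : nat) : (0 < nth_prime i)%N.
  exact/prime_gt0/nth_prime_prime.
(* The count runs over 1 to [primorial k], the Chinese remainder sum from 0 to [primorial k - 1];
   periodicity exchanges the two endpoints. *)
have gamma_period : gamma r (primorial k) = gamma r 0.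
  apply: eq_card => i; rewrite !inE !eqz_modnE //.
  by rewrite /primorial (bigD1 i) //= modnMr mod0n.
have -> : \sum_(n < (primorial k).+1 | (0 < n)%N) 'X^(gamma r n)
    = \sum_(n < primorial k) 'X^(gamma r n) :> {poly int}.
  have P_gt0 : (0 < primorial k)%N by rewrite prodn_gt0.
  rewrite big_mkcond big_ord_recl /= add0r -(prednK P_gt0).
  rewrite big_ord_recr [RHS]big_ord_recl addrC /=; congr (_ + _).
  by rewrite /bump add1n prednK // gamma_period.
under eq_bigr do rewrite Xn_gammaE.
rewrite (@sum_chinese_prod _ _ _ (fun i : 'I_k => nth_prime i)
  (fun i a => if a == `|(r i %% (nth_prime i)%:Z)%Z|%N then 'X else 1)) //;
  first last.
- exact: index_enum_uniq.
- move=> i j neq_ij; rewrite prime_coprime ?nth_prime_prime //.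
  rewrite dvdn_prime2 ?nth_prime_prime //.
  by apply: contra neq_ij => /eqP/nth_prime_inj/val_inj ->.
apply: eq_bigr => i _; set s := `|_|%N.
have s_lt : (s < nth_prime i)%N.
  rewrite -ltz_nat gez0_abs; first by rewrite ltz_pmod ?ltz_nat.
  by rewrite modz_ge0 // eqz_nat -lt0n.
rewrite (bigD1 (Ordinal s_lt)) //= eqxx addrC; congr (_ + _).
under eq_bigr => a ne_as do rewrite ifN //.
rewrite sumr_const cardC1 card_ord -subn1 natrB // polyCB.
by rewrite -[(nth_prime i)%:Z]natz rmorph_nat.
Qed.

Lemma coef_sum_Xn (I : finType) (P : pred I) (g : I -> nat) (m : nat) :
  (\sum_(n | P n) 'X^(g n) : {poly int})`_m
    = #|[set n | P n && (g n == m)]|%:Z.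
Proof.
rewrite coef_sum; under eq_bigr do rewrite coefXn eq_sym.
by rewrite -sum1dep_card big_mkcondr /= -natr_sum natz.
Qed.

Theorem theorem1 (k : nat) (hk : (0 < k)%N) (r : 'I_k -> int) :
  #|[set n : 'I_(primorial k).+1 | (0 < n)%N && available r n]|%:Z
    = avail_det k
  /\
  #|[set n : 'I_(primorial k).+1 | (0 < n)%N && free_int r n]|%:Z
    = free_det k.
Proof.
split.
  rewrite /avail_det /avail_mx det_offdiag1 /= -(sum_X_gamma r).
  rewrite !coef_sum_Xn -PoszD; congr Posz.
  (* The sets where [gamma] is 0 and where it is 1 are disjoint, so their sizes add up to that of
     their union. *)
  rewrite -cardsUI [X in (_ + X)%N]eq_card0 => [|n]; last first.
    by rewrite !inE; case: (gamma r n) => [|m]; rewrite !andbF.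
  rewrite addn0; apply: eq_card => n; rewrite !inE -andb_orr.
  by rewrite /available; case: (gamma r n) => [|[|m]].
rewrite /free_det /free_mx (@det_subdiag_row1 _ _ (fun j => (nth_prime j)%:Z)).
(* The sign in [free_det] cancels the one from the cofactor. *)
rewrite mulrA -exprMn mulrNN mulr1 expr1n mul1r.
by rewrite -coef0_prod_CaddX -(sum_X_gamma r) coef_sum_Xn.
Qed.
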